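(* Let $a\le x<x'\le b$ be real numbers, $0<\alpha\le\frac12$, $y=(1-\alpha)x+\alpha x'$, $y'=\alpha x+(1-\alpha)x'$, $\Omega=[x,y]\cup[y',x']$. Let $f:[a,b]\to\mathbb{R}$ be convex and let $p:[x,x']\to[0,\infty)$ be integrable and symmetric about $\frac{x+x'}{2}$. Let $\mathrm{Ip}_2:[0,1]\to\mathbb{R}$ be the function defined in the context. Then: (1) $$\begin{aligned}&2f\left(\frac{y+y'}{2}\right)\int_x^{x'}p(s)\,ds\\&\le\frac2\alpha\left[\int_{\frac{x+y'}{2}}^{\frac{y+y'}{2}}f(s)\,p\left(\frac1\alpha(2s-x-y')+x\right)ds+\int_{\frac{y+y'}{2}}^{\frac{x'+y}{2}}f(s)\,p\left(\frac1\alpha(2s-y-x')+x'\right)ds\right]\\&\le\int_0^1\mathrm{Ip}_2(t)\,dt\\&\le\frac12\left[(f(y)+f(y'))\int_x^{x'}p(s)\,ds+\int_x^{x'}\left[f((1-\alpha)x+\alpha s)+f((1-\alpha)x'+\alpha s)\right]p(s)\,ds\right].\end{aligned}$$ (2) If $f$ is differentiable on $[x,x']$ and $p$ is bounded on $[x,x']$, then for all $t\in[0,1]$ $$\begin{aligned}0&\le\int_x^{x'}\left[f((1-\alpha)x+\alpha s)+f((1-\alpha)x'+\alpha s)\right]p(s)\,ds-\mathrm{Ip}_2(t)\\&\le\frac{1-t}{\alpha}\left[(f(x)+f(x'))(y'-x)-(f(y)+f(y'))(y'-y)-\int_\Omega f(s)\,ds\right]\|p\|_\infty.\end{aligned}$$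 (3) If $f$ is differentiable on $[x,x']$, then for all $t\in[0,1]$ $$0\le \mathrm{Ip}_2(t)-2f\left(\frac{y+y'}{2}\right)\int_x^{x'}p(s)\,ds\le\frac{2x'-y-y'}{2}(f'(x')-f'(x))\int_x^{x'}p(s)\,ds$$ and $$0\le[f(x)+f(x')]\int_x^{x'}p(s)\,ds-\mathrm{Ip}_2(t)\le\frac{2x'-y-y'}{2}(f'(x')-f'(x))\int_x^{x'}p(s)\,ds.$$
   Context: Symmetric about $\frac{x+x'}{2}$ means $p(s)=p(x+x'-s)$ for $s\in[x,x']$. $\|p\|_\infty=\sup_{s\in[x,x']}|p(s)|$. For $t\in[0,1]$ define $$\mathrm{Ip}_2(t)=\int_x^{x'}\left[f\big(t((1-\alpha)x+\alpha s)+(1-t)y'\big)+f\big(t((1-\alpha)x'+\alpha s)+(1-t)y\big)\right]p(s)\,ds.$$ *)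

(* Defs.v *)
From HB Require Import structures.
From mathcomp Require Import all_boot all_order all_algebra.
From mathcomp Require Import all_classical all_reals all_analysis.

Set Implicit Arguments.
Unset Strict Implicit.
Unset Printing Implicit Defensive.

Import Order.TTheory GRing.Theory Num.Theory.
Import numFieldNormedType.Exports.

Local Open Scope classical_set_scope.
Local Open Scope ring_scope.

(* [lebesgue_measure] lives on the Borel sigma-algebra, for which "integrable"
   would require Borel measurability; the completed measure gives the usual
   Lebesgue-integrable functions. *)
Notation leb := completed_lebesgue_measure.

(* The library's [derivable] and [derive1] are two-sided; these are relative to
   a domain [A], hence one-sided at the endpoints of a compact interval. *)
Definition derivable_within (R : realType) (A : set R) (f : R -> R) (s : R) :=
  cvg ((fun h : R => h^-1 * (f (h + s) - f s))
         @ within [set h | A (h + s)] 0^').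

Definition derive_within (R : realType) (A : set R) (f : R -> R) (s : R) : R :=
  lim ((fun h : R => h^-1 * (f (h + s) - f s))
         @ within [set h | A (h + s)] 0^').

Definition sup_norm (R : realType) (A : set R) (p : R -> R) : R :=
  sup [set `|p s| | s in A].

Definition Ip2 (R : realType) (x x' alpha : R) (f p : R -> R) (t : R) : R :=
  let y := (1 - alpha) * x + alpha * x' in
  let y' := alpha * x + (1 - alpha) * x' in
  \int[leb]_(s in `[x, x'])
    ((f (t * ((1 - alpha) * x + alpha * s) + (1 - t) * y') +
      f (t * ((1 - alpha) * x' + alpha * s) + (1 - t) * y)) * p s).

(* Main.v *)
(* Put g z = f z + f (x + x' - z), a convex function symmetric about the
   midpoint, and u s = (1 - alpha) x + alpha s.  Reflecting s in the second half
   of Ip_2 and using the symmetry of p gives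
     Ip_2 t = \int g (t u s + (1 - t) y') p s ds.
   The bound g mid <= g <= g x on [x, x'], with the tangents of f at x and x',
   gives (3) and the first inequality of (1).  Since t |-> Ip_2 t is convex and
   the change of variables turns the second term of (1) into Ip_2 (1/2), the
   rest of (1) is the Hermite-Hadamard inequality on [0, 1].
   For (2), u s <= t u s + (1 - t) y' <= x + x' - u s makes the integrand of
   Ip_2 1 - Ip_2 t nonnegative, so p may be replaced by its supremum.  Let G t be
   the integral above for p = 1.  It is convex, so its chord slopes to t = 1
   are at most the one near 1; and since r G r is 1 / alpha times the integral
   of g over a shifted interval, that slope is controlled by the values of g
   near x and y, without integration by parts. *)
Require Import Defs.
From HB Require Import structures.
From mathcomp Require Import all_boot all_order all_algebra.
From mathcomp Require Import all_classical all_reals all_analysis.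
From mathcomp Require Import measurable_realfun ring lra.

Set Implicit Arguments.
Unset Strict Implicit.
Unset Printing Implicit Defensive.

Import Order.TTheory GRing.Theory Num.Theory.
Import numFieldNormedType.Exports.

Local Open Scope classical_set_scope.
Local Open Scope ring_scope.

(* The carrier of [leb]: the reals with the Lebesgue measurable sets, as opposed
   to [measurableTypeR R], which carries the Borel sets. *)
Local Notation lebT R := (caratheodory_type ((@wlength R idfun)^*)%mu).

(** * Change of variables under a map that scales the measure *)

Section scaling_change_of_variables.
Context d (T : measurableType d) (R : realType).
Variables (mu : {measure set T -> \bar R}) (phi : T -> T) (c : R).
Hypotheses (c_gt0 : 0 < c) (mphi : measurable_fun setT phi).
Hypothesis mu_phi : forall A, measurable A ->
  (mu A = c%:E * mu (phi @^-1` A))%E.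
Variable D : set T.
Hypothesis mD : measurable D.

(** By [mu_phi], [mu] agrees on measurable sets with [c] times its own image under [phi]; integrals
    then follow from the rules for scaled and pushforward measures. *)
Lemma ge0_integral_scaling (F : T -> \bar R) :
  measurable_fun D F -> (forall s, 0 <= F s)%E ->
  (\int[mu]_(s in D) F s = c%:E * \int[mu]_(s in phi @^-1` D) F (phi s))%E.
Proof.
move=> mF F0; pose k : {nonneg R} := NngNum (ltW c_gt0).
pose nu : {measure set T -> \bar R} :=
  measure_function_pushforward__canonical__measure_function_Measure mu mphi.
transitivity (\int[mscale k nu]_(s in D) F s)%E.
  by apply: eq_measure_integral => A mA _; exact: mu_phi.
by rewrite ge0_integral_mscale // ge0_integral_pushforward.
Qed.

Lemma integrable_scaling (F : T -> R) :
  mu.-integrable D (EFin \o F) ->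
  mu.-integrable (phi @^-1` D) (EFin \o (F \o phi)).
Proof.
move=> /integrableP[mF Foo]; apply/integrableP; split.
  apply: (measurable_comp mD _ mF); first by move=> _ [s Ds <-].
  exact: measurable_funS mphi.
(* The integral of the absolute value of [F] is [c] times that of [F \o phi], so an infinite second
   integral would make the first infinite. *)
move: Foo; rewrite ge0_integral_scaling // ?ltey; last exact: measurableT_comp.
by apply: contra_neq => ->; rewrite gt0_muley // lte_fin.
Qed.

Lemma Rintegral_scaling (F : T -> R) :
  mu.-integrable D (EFin \o F) ->
  \int[mu]_(s in D) F s = c * \int[mu]_(s in phi @^-1` D) F (phi s).
Proof.
move=> iF; have iFphi := integrable_scaling iF.
have /integrableP[mF _] := iF.
have mphiD : measurable (phi @^-1` D).
  by rewrite -[X in measurable X]setTI; exact: mphi.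
have posE : ((EFin \o (F \o phi))^\+ = (EFin \o F)^\+ \o phi)%E.
  by apply/funext => s; rewrite /= !funeposE.
have negE : ((EFin \o (F \o phi))^\- = (EFin \o F)^\- \o phi)%E.
  by apply/funext => s; rewrite /= !funenegE.
have := integrable_pos_fin_num mphiD iFphi; rewrite posE => fp.
have := integrable_neg_fin_num mphiD iFphi; rewrite negE => fn.
rewrite /Rintegral integralE [in RHS]integralE posE negE.
rewrite ge0_integral_scaling //; last exact: measurable_funepos.
rewrite [X in (_ - X)%E]ge0_integral_scaling //; last exact: measurable_funeneg.
(* Distributing [c] over the difference of the two parts is legitimate in the extended reals because
   integrability makes them finite. *)
rewrite -muleBr //; last exact: (fin_num_adde_defr _ fp).
by rewrite fineM // fin_numB; apply/andP; split.
Qed.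
End scaling_change_of_variables.

(** * Affine maps and the completed Lebesgue measure *)

Section affine_change_of_variables.
Variable R : realType.
Implicit Types (k m : R) (A D : set R).

Lemma borel_measurable_affine k m : measurable_fun setT
  (fun s : measurableTypeR R => k * s + m : measurableTypeR R).
Proof. by apply: measurable_funD => //; exact: mulrl_measurable. Qed.

Lemma preimage_affine_pos k m (b1 b2 : bool) a b : 0 < k ->
  (fun s => k * s + m) @^-1` [set` Interval (BSide b1 a) (BSide b2 b)] =
  [set` Interval (BSide b1 ((a - m) / k)) (BSide b2 ((b - m) / k))].
Proof.
move=> k0; apply/seteqP; split=> s /=; rewrite !in_itv /=;
 case: b1; case: b2 => /=;
 by rewrite ?ler_pdivrMr ?ltr_pdivrMr ?ler_pdivlMr ?ltr_pdivlMr //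
  ![s * k]mulrC ?lerBlDr ?ltrBlDr ?lerBrDr ?ltrBrDr.
Qed.

(** A boundary [BSide true] is closed as a left end and open as a right end, hence the negations
    when a decreasing map swaps the ends. *)
Lemma preimage_affine_neg k m (b1 b2 : bool) a b : k < 0 ->
  (fun s => k * s + m) @^-1` [set` Interval (BSide b1 a) (BSide b2 b)] =
  [set` Interval (BSide (~~ b2) ((b - m) / k)) (BSide (~~ b1) ((a - m) / k))].
Proof.
move=> k0; apply/seteqP; split=> s /=; rewrite !in_itv /= andbC;
 case: b1; case: b2 => /=;
 by rewrite ?ler_ndivrMr ?ltr_ndivrMr ?ler_ndivlMr ?ltr_ndivlMr //
  ![s * k]mulrC ?lerBlDr ?ltrBlDr ?lerBrDr ?ltrBrDr.
Qed.

(** By uniqueness of Lebesgue measure it suffices to compare both sides on half-open intervals,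
    where the preimage is again an interval of explicit length. *)
Lemma lebesgue_measure_affine k m A : k != 0 ->
  (measurable : set (set (measurableTypeR R))) A ->
  (lebesgue_measure A =
   `|k|%:E * lebesgue_measure ((fun s => k * s + m)%R @^-1` A))%E.
Proof.
move=> k0 mA; have mphi := borel_measurable_affine k m.
pose k1 : {nonneg R} := NngNum (normr_ge0 k).
rewrite (@lebesgue_measure_unique _ (mscale k1 (pushforward lebesgue_measure
  (fun s : measurableTypeR R => k * s + m : measurableTypeR R)))) //.
move=> _ [[a b] _ <-].
change (lebesgue_measure `]a, b] =
  `|k|%:E * lebesgue_measure ((fun s => (k * s + m)%R) @^-1` `]a, b]))%E.
case: (ltgtP k 0) k0 => // k0 _.
- rewrite [X in (_ = _ * lebesgue_measure X)%E]
    (preimage_affine_neg m false false a b k0).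
  rewrite !lebesgue_measure_itv /= !lte_fin.
  rewrite ltr_nM2r ?invr_lt0 // ltrD2r.
  case: ifP => _; last by rewrite mule0.
  rewrite -!EFinD -EFinM; congr _%:E.
  by rewrite ltr0_norm //; field; rewrite lt_eqF.
- rewrite [X in (_ = _ * lebesgue_measure X)%E]
    (preimage_affine_pos m false false a b k0).
  rewrite !lebesgue_measure_itv /= !lte_fin.
  rewrite ltr_pM2r ?invr_gt0 // ltrD2r.
  case: ifP => _; last by rewrite mule0.
  rewrite -!EFinD -EFinM; congr _%:E.
  by rewrite gtr0_norm //; field; rewrite gt_eqF.
Qed.

Lemma leb_borel A : (measurable : set (set (measurableTypeR R))) A ->
  (measurable : set (set (lebT R))) A.
Proof. exact: sub_caratheodory. Qed.

(** The Caratheodory sets coincide with the completion of the Borel sets, whose members are Borel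
    sets enlarged by a subset of a null Borel set. *)
Lemma leb_borelP A : (measurable : set (set (lebT R))) A ->
  exists B N, [/\ (measurable : set (set (measurableTypeR R))) B,
    (measurable : set (set (measurableTypeR R))) N,
    lebesgue_measure N = 0%E, B `<=` A & A `<=` B `|` N].
Proof.
move=> mA; have : (completed_algebra_gen lebesgue_measure).-sigma.-measurable A.
  by rewrite completed_caratheodory_measurable.
rewrite g_sigma_completed_algebra_genE => -[B mB [N [N' [mN' N'0 NN']]] <-].
by exists B, N'; split => //; exact: setUS.
Qed.

(** Borel measurability of the map is not enough, since the target carries the completed
    sigma-algebra as well: null sets must also pull back to null sets, which the scaling formula
    provides. *)
Lemma leb_measurable_affine k m : k != 0 ->
  measurable_fun setT (fun s : lebT R => k * s + m : lebT R).
Proof.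
move=> k0 _ A /leb_borelP [B [N [mB mN N0 BA AN]]]; rewrite setTI.
have mpre C : (measurable : set (set (measurableTypeR R))) C ->
    (measurable : set (set (measurableTypeR R))) ((fun s => k * s + m) @^-1` C).
  by move=> mC; rewrite -[X in _ X]setTI; exact: borel_measurable_affine.
have preN0 : lebesgue_measure ((fun s => k * s + m) @^-1` N) = 0%E.
  have := lebesgue_measure_affine m k0 mN; rewrite N0 => /esym/eqP.
  by rewrite mule_eq0 eqe normr_eq0 (negbTE k0) /= => /eqP.
set phi := fun s => k * s + m in mpre preN0 *.
have -> : phi @^-1` A = phi @^-1` B `|` (phi @^-1` A `\` phi @^-1` B).
  by rewrite setDUK // => s /BA.
apply: measurableU; first by apply: leb_borel; exact: mpre.
apply: completed_lebesgue_measure_is_complete.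
exists (phi @^-1` N); split.
- apply: leb_borel; exact: mpre.
- exact: preN0.
- by move=> s [/AN []].
Qed.

Lemma leb_affine k m A : k != 0 -> (measurable : set (set (lebT R))) A ->
  (leb A = `|k|%:E * leb ((fun s => k * s + m)%R @^-1` A))%E.
Proof.
move=> k0 /leb_borelP [B [N [mB mN N0 BA AN]]].
have mphi := borel_measurable_affine k m.
set phi := fun s => (k * s + m)%R in mphi *.
have mpre C : (measurable : set (set (measurableTypeR R))) C ->
    (measurable : set (set (measurableTypeR R))) (phi @^-1` C).
  by move=> mC; rewrite -[X in _ X]setTI; exact: mphi.
have preN0 : lebesgue_measure (phi @^-1` N) = 0%E.
  have := lebesgue_measure_affine m k0 mN; rewrite N0 => /esym/eqP.
  by rewrite mule_eq0 eqe normr_eq0 (negbTE k0) /= => /eqP.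
have leBN C D E : (measurable : set (set (measurableTypeR R))) C ->
    (measurable : set (set (measurableTypeR R))) E ->
    lebesgue_measure E = 0%E -> C `<=` D -> D `<=` C `|` E ->
    leb D = lebesgue_measure C :> \bar R.
  (* Both measures are the same outer measure up to conversion, so monotonicity and subadditivity
     compare them directly. *)
  move=> mC mE E0 CD DE; apply/eqP; rewrite eq_le; apply/andP; split.
    apply: (@le_trans _ _ (lebesgue_measure (C `|` E))).
      exact: le_outer_measure.
    by rewrite -[leRHS]adde0 -E0; exact: measureU2.
  exact: le_outer_measure.
rewrite (leBN B A N) // (leBN (phi @^-1` B) (phi @^-1` A) (phi @^-1` N)) //.
- exact: lebesgue_measure_affine.
- exact: mpre.
- exact: mpre.
- by move=> s /BA.
- by move=> s /AN.
Qed.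

Lemma leb_integrable_affine k m D (F : R -> R) : k != 0 ->
  (measurable : set (set (lebT R))) D ->
  leb.-integrable D (EFin \o F) ->
  leb.-integrable ((fun s => k * s + m) @^-1` D)
    (EFin \o (fun s => F (k * s + m))).
Proof.
move=> k0 mD; have k1 : 0 < `|k| by rewrite normr_gt0.
exact: (integrable_scaling k1 (leb_measurable_affine m k0)
  (fun A => @leb_affine k m A k0) mD).
Qed.

Lemma leb_Rintegral_affine k m D (F : R -> R) : k != 0 ->
  (measurable : set (set (lebT R))) D ->
  leb.-integrable D (EFin \o F) ->
  \int[leb]_(s in D) F s =
   `|k| * \int[leb]_(s in (fun s => k * s + m) @^-1` D) F (k * s + m).
Proof.
move=> k0 mD; have k1 : 0 < `|k| by rewrite normr_gt0.
exact: (Rintegral_scaling k1 (leb_measurable_affine m k0)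
  (fun A => @leb_affine k m A k0) mD).
Qed.
End affine_change_of_variables.

(** * Additivity, and integrals over compact intervals *)

Lemma Rintegral_setU_null d (T : measurableType d) (R : realType)
    (mu : {measure set T -> \bar R}) (A B : set T) (F : T -> R) :
  measurable A -> measurable B -> mu (A `&` B) = 0%E ->
  mu.-integrable (A `|` B) (EFin \o F) ->
  \int[mu]_(s in A `|` B) F s = \int[mu]_(s in A) F s + \int[mu]_(s in B) F s.
Proof.
move=> mA mB AB0 iF.
(* Additivity is applied to the disjoint sets [A] and [B] minus [A]; the null overlap is put back at
   the end. This serves closed intervals sharing an endpoint. *)
have AUB : A `|` (B `\` A) = A `|` B by rewrite setUDr setDv setD0.
have iB : mu.-integrable B (EFin \o F).
  by apply: integrableS iF => //; exact: measurableU.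
rewrite -[in LHS]AUB Rintegral_setU //; last 3 first.
- exact: measurableD.
- by rewrite AUB.
- by apply/disj_setPS => s [As []].
congr (_ + _); rewrite /Rintegral (@negligible_integral _ _ _ mu B (A `&` B)) //.
- by rewrite setDIr setDv setU0.
- exact: measurableI.
Qed.

Section leb_intervals.
Variable R : realType.
Implicit Types (u v w k m r : R) (F p : R -> R).

Lemma leb_measurable_itv (i : interval R) :
  (measurable : set (set (lebT R))) [set` i].
Proof. exact: leb_borel. Qed.

Lemma leb_itv u v : u <= v -> leb (`[u, v] : set R) = (v - u)%:E.
Proof.
rewrite le_eqVlt => /predU1P[->|uv].
  have := @lebesgue_measure_itv R `[v, v]; rewrite /= ltxx subrr; exact.
have := @lebesgue_measure_itv R `[u, v]; rewrite /= lte_fin uv; exact.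
Qed.

Lemma leb_itv_lty u v : (leb (`[u, v] : set R) < +oo)%E.
Proof.
have [uv|vu] := leP u v; first by rewrite leb_itv // ltry.
by rewrite set_itv_ge -?ltNge // measure0.
Qed.

Lemma leb_Rintegral_cst u v r : u <= v ->
  \int[leb]_(s in `[u, v]) r = r * (v - u).
Proof.
move=> uv; rewrite Rintegral_cst; last exact: leb_measurable_itv.
exact: (congr1 (fun z => r * fine z) (leb_itv uv)).
Qed.

Lemma leb_integrable_sub u v u' v' F : u <= u' -> v' <= v ->
  leb.-integrable `[u, v] (EFin \o F) -> leb.-integrable `[u', v'] (EFin \o F).
Proof.
move=> uu vv; apply: integrableS; try exact: leb_measurable_itv.
by apply: subset_itv; rewrite bnd_simp.
Qed.

Lemma leb_Rintegral_cat u v w F : u <= v -> v <= w ->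
  leb.-integrable `[u, w] (EFin \o F) ->
  \int[leb]_(s in `[u, w]) F s =
  \int[leb]_(s in `[u, v]) F s + \int[leb]_(s in `[v, w]) F s.
Proof.
move=> uv vw iF.
have E : `[u, w]%classic = `[u, v] `|` `[v, w].
  apply/seteqP; split => s /=; rewrite !in_itv /=.
    by move=> /andP[us sw]; have [sv|/ltW vs] := leP s v; [left|right]; apply/andP.
  move=> [|] /andP[? ?]; apply/andP; split => //;
    [exact: le_trans vw|exact: le_trans uv _].
rewrite [in LHS]E Rintegral_setU_null //; try exact: leb_measurable_itv.
- rewrite (_ : _ `&` _ = `[v, v]%classic).
    by apply: (etrans (leb_itv (lexx v))); rewrite subrr.
  apply/seteqP; split => s /=; rewrite !in_itv /=.
    by move=> [/andP[_ sv] /andP[vs _]]; apply/andP.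
  by move=> /le_anti <-; rewrite uv vw lexx.
- by rewrite -E.
Qed.

Lemma itv_preimage_affine k m u v : 0 < k ->
  (fun s => k * s + m) @^-1` `[k * u + m, k * v + m] = `[u, v]%classic.
Proof.
by move=> k0; rewrite preimage_affine_pos // !addrK ![k * _]mulrC !mulfK ?gt_eqF.
Qed.

Lemma leb_Rintegral_itv_affine k m u v F : 0 < k ->
  leb.-integrable `[k * u + m, k * v + m] (EFin \o F) ->
  \int[leb]_(s in `[k * u + m, k * v + m]) F s =
  k * \int[leb]_(s in `[u, v]) F (k * s + m).
Proof.
move=> k0 iF; rewrite (@leb_Rintegral_affine R k m) ?gt_eqF //.
  by rewrite itv_preimage_affine // gtr0_norm.
exact: leb_measurable_itv.
Qed.

Lemma itv_preimage_reflect w u v :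
  (fun s => -1 * s + w) @^-1` `[u, v] = `[w - v, w - u]%classic.
Proof.
rewrite preimage_affine_neg ?ltrN10 //= !invrN1 !mulrN1.
by rewrite !opprB.
Qed.

Lemma leb_integrable_reflect w u v F :
  leb.-integrable `[u, v] (EFin \o F) ->
  leb.-integrable `[w - v, w - u] (EFin \o (fun s => F (w - s))).
Proof.
move=> iF; rewrite -itv_preimage_reflect.
rewrite (_ : (fun s => F (w - s)) = (fun s => F (-1 * s + w))); last first.
  by apply/funext => s; rewrite mulN1r addrC.
have N10 : -1 != 0 :> R by rewrite oppr_eq0 oner_eq0.
exact: (leb_integrable_affine w N10 (leb_measurable_itv _)).
Qed.

Lemma leb_Rintegral_reflect w u v F :
  leb.-integrable `[u, v] (EFin \o F) ->
  \int[leb]_(s in `[u, v]) F s = \int[leb]_(s in `[w - v, w - u]) F (w - s).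
Proof.
move=> iF; have N10 : -1 != 0 :> R by rewrite oppr_eq0 oner_eq0.
rewrite (leb_Rintegral_affine w N10 (leb_measurable_itv _)) //.
rewrite itv_preimage_reflect normrN1 mul1r.
by apply: eq_Rintegral => s _; rewrite mulN1r addrC.
Qed.
End leb_intervals.

(** * Convex functions on an interval and the Hermite-Hadamard inequality *)

Definition convex_on (R : realType) (u v : R) (F : R -> R) :=
  forall s1 s2 t, u <= s1 <= v -> u <= s2 <= v -> 0 <= t <= 1 ->
    F (t * s1 + (1 - t) * s2) <= t * F s1 + (1 - t) * F s2.

Section convex_on.
Variable R : realType.
Implicit Types (u v w k m r : R) (F G p : R -> R).

(** In [convex_on] the weight is a plain real and membership is an inequality, which suits [lra] and
    [nra]; [Itv01] packs the weight into the type that [convex_function] expects. *)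
Lemma convex_function_on u v F :
  convex_function `[u, v] F -> convex_on u v F.
Proof.
move=> cF s1 s2 t s1uv s2uv t01.
have [t0 t1] := andP t01.
by apply: (cF (Itv01 t0 t1) s1 s2); rewrite inE /= in_itv.
Qed.

Lemma convex_combination_itv u v s1 s2 t : u <= s1 <= v -> u <= s2 <= v ->
  0 <= t <= 1 -> u <= t * s1 + (1 - t) * s2 <= v.
Proof. by move=> /andP[? ?] /andP[? ?] /andP[? ?]; apply/andP; split; nra. Qed.

Lemma convex_on_affine k m u v u' v' F :
  (forall s, u <= s <= v -> u' <= k * s + m <= v') ->
  convex_on u' v' F -> convex_on u v (fun s => F (k * s + m)).
Proof.
move=> uv cF s1 s2 t /uv i1 /uv i2 t01.
rewrite [X in F X <= _](_ : _ = t * (k * s1 + m) + (1 - t) * (k * s2 + m));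
  [exact: cF|ring].
Qed.

Lemma convex_on_sub u v u' v' F : u' <= u -> v <= v' ->
  convex_on u' v' F -> convex_on u v F.
Proof.
move=> uu vv cF s1 s2 t /andP[? ?] /andP[? ?] t01.
by apply: cF => //; apply/andP; split; lra.
Qed.

Lemma convex_onD u v F G : convex_on u v F -> convex_on u v G ->
  convex_on u v (fun s => F s + G s).
Proof.
move=> cF cG s1 s2 t i1 i2 t01.
have := cF _ _ _ i1 i2 t01; have := cG _ _ _ i1 i2 t01; lra.
Qed.

(** The point [s] is the mean of [u] and [v] with weight (v - s) / (v - u) on [u], and a mean of two
    values is at most their maximum. The case [u = v] is separate because of the division. *)
Lemma convex_on_le_max u v F s : convex_on u v F -> u <= s <= v ->
  F s <= Num.max (F u) (F v).
Proof.
move=> cF /andP[us sv]; have uv := le_trans us sv.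
have [e|nuv] := eqVneq u v.
  by rewrite (_ : s = u) ?le_max ?lexx //; apply/eqP; rewrite eq_le us e sv.
have {}uv : u < v by rewrite lt_neqAle nuv.
have t01 : 0 <= (v - s) / (v - u) <= 1.
  by rewrite ler_pdivrMr ?subr_gt0 // divr_ge0 ?subr_ge0 //=; lra.
have := cF u v _ _ _ t01; rewrite [X in F X <= _](_ : _ = s); last first.
  by field; rewrite subr_eq0 gt_eqF.
rewrite !lexx ltW //= => /(_ isT isT) /le_trans; apply.
set t := (v - s) / _ in t01 *.
have Mu : F u <= Num.max (F u) (F v) by rewrite le_max lexx.
have Mv : F v <= Num.max (F u) (F v) by rewrite le_max lexx orbT.
by move: (Num.max _ _) Mu Mv => M Mu Mv; move/andP : t01 => [? ?]; nra.
Qed.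

(** From above, the larger end value [B] is a bound. From below, convexity at the midpoint gives 2 c
    <= F s + F (u + v - s) with [c] the value there, and the last term is at most [B], so F s >= 2 c
    - B. *)
Lemma convex_on_bounded u v F : convex_on u v F ->
  [bounded F s | s in `[u, v]].
Proof.
move=> cF; set B := Num.max (F u) (F v); set c := F ((u + v) / 2).
exists (`|B| + `|2 * c - B|); split; first exact: num_real.
move=> M BM s /=; rewrite in_itv /= => suv.
have sB := convex_on_le_max cF suv.
have [us sv] := andP suv.
have suv' : u <= u + v - s <= v by apply/andP; split; lra.
have s'B := convex_on_le_max cF suv'.
have h01 : 0 <= (2^-1 : R) <= 1 by lra.
have := cF _ _ _ suv suv' h01.
rewrite [X in F X <= _](_ : _ = (u + v) / 2) -/c; last by field.
rewrite -/B in sB s'B.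
have := ler_norm B; have := ler_norm (- (2 * c - B)); rewrite normrN.
have := normr_ge0 B; have := normr_ge0 (2 * c - B).
by move=> *; rewrite ler_norml; apply/andP; split; lra.
Qed.

(* The sublevel sets of a convex function are intervals. *)
Lemma convex_on_measurable u v F : convex_on u v F ->
  measurable_fun (`[u, v] : set (lebT R)) F.
Proof.
move=> cF.
suff bF : measurable_fun (`[u, v] : set (measurableTypeR R)) F.
  by move=> _ A mA; apply: leb_borel; exact: bF.
apply: (measurability (@RGenInftyO.G R)) => [|/= _ [_] [r] -> <-].
  exact: RGenInftyO.measurableE.
apply: is_interval_measurable => s1 s2 /= [].
rewrite !in_itv /= => i1 F1 [] i2 F2 s /andP[s1s ss2].
have [e|ne] := eqVneq s1 s2.
  by rewrite (_ : s = s1) //; apply/eqP; rewrite eq_le s1s {1}e ss2.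
have s12 : s1 < s2 by rewrite lt_neqAle ne (le_trans s1s).
have ss1s2 : s1 <= s <= s2 by apply/andP.
have cF' : convex_on s1 s2 F.
  by apply: convex_on_sub cF; [case/andP: i1|case/andP: i2].
have Fs : F s < r.
  by apply: (le_lt_trans (convex_on_le_max cF' ss1s2)); rewrite gt_max F1.
move: i1 i2 => /andP[us1 _] /andP[_ s2v].
by split; rewrite in_itv //= (le_trans us1) // (le_trans ss2).
Qed.

Lemma convex_on_integrable u v F : convex_on u v F ->
  leb.-integrable `[u, v] (EFin \o F).
Proof.
move=> cF; apply: measurable_bounded_integrable.
- exact: leb_measurable_itv.
- exact: leb_itv_lty.
- exact: convex_on_measurable.
- exact: convex_on_bounded.
Qed.

Lemma convex_on_mul_integrable u v F p : convex_on u v F ->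
  leb.-integrable `[u, v] (EFin \o p) ->
  leb.-integrable `[u, v] (EFin \o (fun s => F s * p s)).
Proof.
move=> cF ip; apply: (integrableMr _ (convex_on_measurable cF) _ ip).
  exact: leb_measurable_itv.
exact: convex_on_bounded.
Qed.

Lemma leb_integrable_cst u v r : leb.-integrable `[u, v] (EFin \o cst r).
Proof. by apply: convex_on_integrable => s1 s2 t _ _ _ /=; lra. Qed.

(** The lower bound is convexity at the midpoint of [t] and [1 - t]; the upper one adds the chord
    bounds at these two points. *)
Lemma convex_on_reflect_sum F t : convex_on 0 1 F -> 0 <= t <= 1 ->
  2 * F (1 / 2) <= F t + F (1 - t) <= F 0 + F 1.
Proof.
move=> cF t01; have [t0 t1] := andP t01.
have t01' : 0 <= 1 - t <= 1 by apply/andP; split; lra.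
have h01 : 0 <= (2^-1 : R) <= 1 by apply/andP; split; lra.
have i0 : 0 <= (0 : R) <= 1 by lra.
have i1 : 0 <= (1 : R) <= 1 by lra.
have := cF _ _ _ t01 t01' h01.
rewrite [X in F X <= _](_ : _ = 1 / 2); last by field.
have := cF _ _ _ i1 i0 t01; have := cF _ _ _ i1 i0 t01'.
rewrite !mulr0 !mulr1 !addr0 => *; apply/andP; split; lra.
Qed.

(** Reflecting [t] to [1 - t] shows that the integral of F t + F (1 - t) is twice that of [F]; its
    integrand lies between two constants. *)
Lemma hermite_hadamard F : convex_on 0 1 F ->
  F (1 / 2) <= \int[leb]_(t in `[0, 1]) F t <= 1 / 2 * (F 0 + F 1).
Proof.
move=> cF; have iF := convex_on_integrable cF.
have iF' := leb_integrable_reflect 1 iF; rewrite subrr subr0 in iF'.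
have refl := leb_Rintegral_reflect 1 iF; rewrite subrr subr0 in refl.
have m01 := @leb_measurable_itv R `[0, 1].
have isum : leb.-integrable `[0, 1] (EFin \o (fun t => F t + F (1 - t))).
  exact: (integrableD m01 iF iF').
have cst01 r : \int[leb]_(t in `[0, 1]) r = r.
  by rewrite leb_Rintegral_cst // subr0 mulr1.
have sum : \int[leb]_(t in `[0, 1]) (F t + F (1 - t)) =
    2 * \int[leb]_(t in `[0, 1]) F t.
  by rewrite RintegralD // -refl mulr2n mulrDl mul1r.
have lo : 2 * F (1 / 2) <= 2 * \int[leb]_(t in `[0, 1]) F t.
  rewrite -(cst01 (2 * F (1 / 2))) -sum.
  apply: (le_Rintegral m01 (leb_integrable_cst _ _ _) isum) => t.
  by rewrite /= in_itv /= => /(convex_on_reflect_sum cF)/andP[].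
have hi : 2 * \int[leb]_(t in `[0, 1]) F t <= F 0 + F 1.
  rewrite -(cst01 (F 0 + F 1)) -sum.
  apply: (le_Rintegral m01 isum (leb_integrable_cst _ _ _)) => t.
  by rewrite /= in_itv /= => /(convex_on_reflect_sum cF)/andP[].
move: lo hi; rewrite ler_pM2l // => -> hi /=.
by rewrite mul1r ler_pdivlMl.
Qed.
End convex_on.

(** * Chord inequality, passage to the limit, and weighted integrals *)

Section more_convex.
Variable R : realType.
Implicit Types (u v w k m r : R) (F G p H : R -> R).

(** The chord inequality cleared of denominators, so that coinciding points are allowed and the
    result is ready for linear arithmetic. *)
Lemma convex_on_three_points u v F s1 s2 s3 : convex_on u v F ->
  u <= s1 -> s1 <= s2 -> s2 <= s3 -> s3 <= v ->
  (s3 - s1) * F s2 <= (s3 - s2) * F s1 + (s2 - s1) * F s3.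
Proof.
move=> cF us1 s12 s23 s3v.
have [e|ne] := eqVneq s1 s3.
  have -> : s2 = s1 by apply/eqP; rewrite eq_le s12 andbT e.
  by rewrite e; lra.
have s13 : s1 < s3 by rewrite lt_neqAle ne (le_trans s12).
have d0 : 0 < s3 - s1 by rewrite subr_gt0.
pose t := (s3 - s2) / (s3 - s1).
have t01 : 0 <= t <= 1.
  apply/andP; split; first by apply: divr_ge0; lra.
  by rewrite ler_pdivrMr //; lra.
have i1 : u <= s1 <= v by rewrite us1 (le_trans _ s3v) // ltW.
have i3 : u <= s3 <= v by rewrite s3v (le_trans us1) // ltW.
have := cF _ _ _ i1 i3 t01; rewrite [X in F X <= _](_ : _ = s2); last first.
  by rewrite /t; field; rewrite subr_eq0 gt_eqF.
rewrite -(ler_pM2l d0) => /le_trans; apply.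
rewrite le_eqVlt; apply/orP; left; apply/eqP.
by rewrite /t; field; rewrite subr_eq0 gt_eqF.
Qed.

(** This is the limit [e] to 0 without topology. If [B < X], an [e] with [C * e] at most half of
    [X - B] gives a contradiction; [C1] is a positive bound of [C], which makes the division
    safe. *)
Lemma ler_limit X B C (d : R) : 0 < d ->
  (forall e : R, 0 < e <= d -> X <= B + C * e) -> X <= B.
Proof.
move=> d0 h; rewrite leNgt; apply/negP => BX.
pose C1 := `|C| + 1; have C10 : 0 < C1 by rewrite ltr_wpDl.
pose e := Num.min d ((X - B) / (2 * C1)).
have e0 : 0 < e by rewrite lt_min d0 divr_gt0 ?subr_gt0 // mulr_gt0.
have ed : e <= d by rewrite ge_min lexx.
have eX : e * (2 * C1) <= X - B.
  by rewrite -ler_pdivlMr ?mulr_gt0 // ge_min lexx orbT.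
have := h e; rewrite e0 ed => /(_ isT).
have CC : C <= C1 by rewrite /C1; have := ler_norm C; lra.
have := ler_wpM2r (ltW e0) CC; clearbody e; clearbody C1; lra.
Qed.

(** The affine formula is applied to the inverse map, so integrability is asked only of [H] on
    [[u, v]]. *)
Lemma leb_Rintegral_substitution k m u v H : 0 < k ->
  leb.-integrable `[u, v] (EFin \o H) ->
  \int[leb]_(s in `[k * u + m, k * v + m]) H (k^-1 * s + - m / k) =
  k * \int[leb]_(s in `[u, v]) H s.
Proof.
move=> k0 iH; have kV0 : 0 < k^-1 by rewrite invr_gt0.
have inv s : k^-1 * (k * s + m) + - m / k = s by field; rewrite gt_eqF.
have := @leb_Rintegral_itv_affine R k^-1 (- m / k) (k * u + m) (k * v + m) H kV0.
by rewrite !inv => -> //; rewrite mulVKf ?gt_eqF.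
Qed.

Lemma weighted_integral_bounds u v F p (lo hi : R) : convex_on u v F ->
  leb.-integrable `[u, v] (EFin \o p) ->
  (forall s, u <= s <= v -> 0 <= p s) ->
  (forall s, u <= s <= v -> lo <= F s <= hi) ->
  lo * \int[leb]_(s in `[u, v]) p s <= \int[leb]_(s in `[u, v]) (F s * p s)
    <= hi * \int[leb]_(s in `[u, v]) p s.
Proof.
move=> cF ip p0 bF; have muv := @leb_measurable_itv R `[u, v].
have iFp := convex_on_mul_integrable cF ip.
have icp r : leb.-integrable `[u, v] (EFin \o (fun s => r * p s)).
  exact: (integrableZl muv r ip).
rewrite -!RintegralZl //; apply/andP; split; apply: le_Rintegral => // s;
  rewrite /= in_itv /= => suv; have /andP[? ?] := bF s suv;
  by rewrite ler_wpM2r // p0.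
Qed.

(** Convexity in [t] for each [s] survives integration against a nonnegative weight; convexity in
    [s] for each [t] supplies the integrability. *)
Lemma convex_on_weighted_integral u v (F : R -> R -> R) p :
  leb.-integrable `[u, v] (EFin \o p) ->
  (forall s, u <= s <= v -> 0 <= p s) ->
  (forall t, 0 <= t <= 1 -> convex_on u v (F t)) ->
  (forall s, u <= s <= v -> convex_on 0 1 (F^~ s)) ->
  convex_on 0 1 (fun t => \int[leb]_(s in `[u, v]) (F t s * p s)).
Proof.
move=> ip p0 cF cF' t1 t2 t t1i t2i t01.
have muv := @leb_measurable_itv R `[u, v].
have iF r : 0 <= r <= 1 ->
    leb.-integrable `[u, v] (EFin \o (fun s => F r s * p s)).
  by move=> /cF cFr; exact: convex_on_mul_integrable.
have iZ q r : 0 <= r <= 1 ->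
    leb.-integrable `[u, v] (EFin \o (fun s => q * (F r s * p s))).
  by move=> r01; exact: (integrableZl muv q (iF r r01)).
rewrite -!RintegralZl //; try exact: iF.
rewrite -RintegralD //; try exact: iZ.
apply: le_Rintegral => //.
- by apply: iF; exact: convex_combination_itv.
- exact: (integrableD muv (iZ _ _ t1i) (iZ _ _ t2i)).
move=> s; rewrite /= in_itv /= => suv.
rewrite !mulrA -mulrDl; apply: ler_wpM2r; first exact: p0.
exact: cF'.
Qed.
End more_convex.

(** * Convex functions symmetric about the midpoint *)

Section symmetric_convex.
Variables (R : realType) (x x' : R) (g : R -> R).
Hypothesis cg : convex_on x x' g.
Hypothesis gsym : forall z, g (x + x' - z) = g z.

(** Between [z1] and its mirror image [g] is at most the larger end value, and by symmetry both end
    values equal g z1. *)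
Lemma symmetric_convex_le z1 z2 : x <= z1 -> z1 <= z2 <= x + x' - z1 ->
  g z2 <= g z1.
Proof.
move=> xz1 z12; have z1x' : x + x' - z1 <= x' by lra.
have := convex_on_le_max (convex_on_sub xz1 z1x' cg) z12.
by rewrite gsym maxxx.
Qed.

Lemma symmetric_convex_le_end z : x <= z <= x' -> g z <= g x.
Proof.
by move=> zx; apply: symmetric_convex_le => //; rewrite addrAC subrr add0r.
Qed.

Lemma symmetric_convex_ge_mid z : x <= z <= x' -> g ((x + x') / 2) <= g z.
Proof.
move=> /andP[xz zx']; have [zc|cz] := leP z ((x + x') / 2).
  by apply: symmetric_convex_le => //; apply/andP; split; lra.
rewrite -[leRHS]gsym; apply: symmetric_convex_le; first by lra.
by apply/andP; split; lra.
Qed.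

Section shifted_integral.
Variables (y y' : R).
Hypotheses (xy : x < y) (yy' : y <= y') (y'x' : y' <= x').

(** Sliding the window [[x, y]] to [[a1, b1]] loses the integral over [[x, a1]] and gains the one
    over [[y, b1]]. The lost piece is at most its length times g x; the gained one is at least its
    length times g y, up to an error of second order in [e]. *)
Lemma shifted_integral_le (e : R) : 0 < e <= 1 ->
  \int[leb]_(z in `[x, y]) g z -
    \int[leb]_(z in `[x + e * (y' - x), y + e * (y' - y)]) g z <=
  e * ((y' - x) * g x - (y' - y) * g y +
       (g x - g y) / (y - x) * (y' - y) ^+ 2 * e).
Proof.
move=> e01; have [e0 e1] := andP e01.
set a1 := x + e * (y' - x); set b1 := y + e * (y' - y).
have xa1 : x <= a1 by rewrite lerDl mulr_ge0 ?ltW ?subr_gt0 // (lt_le_trans xy).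
have yb1 : y <= b1 by rewrite lerDl mulr_ge0 ?subr_ge0 // ltW.
have a1b1 : a1 <= b1.
  rewrite -subr_ge0 (_ : _ - _ = (1 - e) * (y - x)); last first.
    by rewrite /a1 /b1; ring.
  by rewrite mulr_ge0 ?subr_ge0 // ltW.
have b1x' : b1 <= x'.
  apply: le_trans y'x'; rewrite -subr_ge0.
  rewrite (_ : _ - _ = (1 - e) * (y' - y)); last by rewrite /b1; ring.
  by rewrite mulr_ge0 ?subr_ge0.
(* Minus the slope of the chord of [g] over [[x, y]]. *)
set K := (g x - g y) / (y - x).
have ig : leb.-integrable `[x, x'] (EFin \o g) by exact: convex_on_integrable.
have Exb := leb_Rintegral_cat (ltW xy) yb1 (leb_integrable_sub (lexx x) b1x' ig).
have Exa := leb_Rintegral_cat xa1 a1b1 (leb_integrable_sub (lexx x) b1x' ig).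
have up : \int[leb]_(z in `[x, a1]) g z <= g x * (a1 - x).
  rewrite -leb_Rintegral_cst //; apply: le_Rintegral.
  - exact: leb_measurable_itv.
  - by apply: leb_integrable_sub ig => //; rewrite (le_trans a1b1).
  - exact: leb_integrable_cst.
  move=> z; rewrite /= in_itv /= => /andP[xz za].
  by apply: symmetric_convex_le_end; rewrite xz (le_trans za) // (le_trans a1b1).
(* Past [y], convexity keeps [g] above the prolonged chord, which descends because g y <= g x and is
   therefore lowest at [b1]. *)
have lo : (g y - K * (b1 - y)) * (b1 - y) <= \int[leb]_(z in `[y, b1]) g z.
  rewrite -leb_Rintegral_cst //; apply: le_Rintegral.
  - exact: leb_measurable_itv.
  - exact: leb_integrable_cst.
  - exact: leb_integrable_sub (ltW xy) _ ig.
  move=> z; rewrite /= in_itv /= => /andP[yz zb].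
  have tp := convex_on_three_points cg (lexx x) (ltW xy) yz (le_trans zb b1x').
  have gyx : g y <= g x.
    apply: symmetric_convex_le_end; rewrite ltW //=.
    by rewrite (le_trans yb1).
  have KE : K * (y - x) = g x - g y by rewrite /K divfK // subr_eq0 gt_eqF.
  have yx0 : 0 < y - x by rewrite subr_gt0.
  rewrite -(ler_pM2r yx0) -[leLHS]/((g y - K * (b1 - y)) * (y - x)).
  have -> : (g y - K * (b1 - y)) * (y - x) =
      g y * (y - x) - (b1 - y) * (K * (y - x)) by ring.
  have : 0 <= (b1 - z) * (g x - g y) by rewrite mulr_ge0 ?subr_ge0.
  by move: tp; rewrite KE; lra.
have b1E : b1 - y = e * (y' - y) by rewrite /b1 addrC addKr.
have a1E : a1 - x = e * (y' - x) by rewrite /a1 addrC addKr.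
rewrite b1E in lo; rewrite a1E in up.
move: (\int[leb]_(z in `[x, a1]) g z) (\int[leb]_(z in `[y, b1]) g z)
  (\int[leb]_(z in `[x, y]) g z) (\int[leb]_(z in `[a1, b1]) g z)
  (\int[leb]_(z in `[x, b1]) g z) Exb Exa up lo => I1 I2 I3 I4 I5 -> E up lo.

by rewrite expr2; lra.
Qed.
End shifted_integral.
End symmetric_convex.

(** * The integral along segments, with a general weight *)

Section contracted_integral.
Variables (R : realType) (x x' alpha : R) (g : R -> R).
Hypotheses (xx' : x < x') (a0 : 0 < alpha) (a12 : alpha <= 1 / 2).
Hypothesis cg : convex_on x x' g.
Hypothesis gsym : forall z, g (x + x' - z) = g z.
Let y := (1 - alpha) * x + alpha * x'.
Let y' := alpha * x + (1 - alpha) * x'.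

(** The argument of [h] runs from [w] at time 0 to the image of [s] under the contraction of
    [[x, x']] onto [[x, y]] at time 1. The weight is left free: [p] gives [Ip2], and [cst 1] gives
    the function G that controls (2). *)
Definition contracted_integral (h : R -> R) (w : R) (p : R -> R) (t : R) :=
  \int[leb]_(s in `[x, x'])
    (h (t * ((1 - alpha) * x + alpha * s) + (1 - t) * w) * p s).

Lemma contracted_order : [/\ x < y, y <= y', y' <= x' & y' = x + x' - y].
Proof.
have h : 0 < alpha * (x' - x) by rewrite mulr_gt0 // subr_gt0.
have h' : 0 <= (1 / 2 - alpha) * (x' - x).
  by rewrite mulr_ge0 // subr_ge0 // ltW.
by split; rewrite /y /y'; lra.
Qed.

Lemma contracted_point_itv s : x <= s <= x' ->
  x <= (1 - alpha) * x + alpha * s <= y.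
Proof.
move=> /andP[xs sx'].
have h : 0 <= alpha * (s - x) by rewrite mulr_ge0 ?subr_ge0 // ltW.
have h' : 0 <= alpha * (x' - s) by rewrite mulr_ge0 ?subr_ge0 // ltW.
by rewrite /y; apply/andP; split; lra.
Qed.

Lemma contracted_segment_itv s t : x <= s <= x' -> 0 <= t <= 1 ->
  x <= t * ((1 - alpha) * x + alpha * s) + (1 - t) * y' <= x'.
Proof.
move=> /contracted_point_itv /andP[us uy] t01.
have [xy yy' y'x' _] := contracted_order.
apply: convex_combination_itv => //; apply/andP; split => //.
- by rewrite (le_trans uy) // (le_trans yy').
- by rewrite (le_trans (ltW xy)).
Qed.

Lemma contracted_convex_point t : 0 <= t <= 1 ->
  convex_on x x' (fun s => g (t * ((1 - alpha) * x + alpha * s) + (1 - t) * y')).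
Proof.
move=> t01.
rewrite (_ : (fun s => _) = (fun s => g (t * alpha * s +
    (t * ((1 - alpha) * x) + (1 - t) * y')))); last first.
  by apply/funext => s; congr g; ring.
apply: convex_on_affine cg => s sx.
rewrite [X in x <= X <= _](_ : _ =
    t * ((1 - alpha) * x + alpha * s) + (1 - t) * y').
  exact: contracted_segment_itv.
by ring.
Qed.

Lemma contracted_convex_time s : x <= s <= x' ->
  convex_on 0 1 (fun t => g (t * ((1 - alpha) * x + alpha * s) + (1 - t) * y')).
Proof.
move=> sx.
rewrite (_ : (fun t => _) =
    (fun t => g (((1 - alpha) * x + alpha * s - y') * t + y'))); last first.
  by apply/funext => t; congr g; ring.
apply: convex_on_affine cg => t t01.
rewrite [X in x <= X <= _](_ : _ =
    t * ((1 - alpha) * x + alpha * s) + (1 - t) * y').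
  exact: contracted_segment_itv.
by ring.
Qed.

Lemma contracted_integral_convex p :
  leb.-integrable `[x, x'] (EFin \o p) ->
  (forall s, x <= s <= x' -> 0 <= p s) ->
  convex_on 0 1 (contracted_integral g y' p).
Proof.
move=> ip p0; apply: convex_on_weighted_integral => //.
- exact: contracted_convex_point.
- exact: contracted_convex_time.
Qed.

Lemma contracted_integral_bounds p t : 0 <= t <= 1 ->
  leb.-integrable `[x, x'] (EFin \o p) ->
  (forall s, x <= s <= x' -> 0 <= p s) ->
  g ((x + x') / 2) * \int[leb]_(s in `[x, x']) p s <=
    contracted_integral g y' p t <= g x * \int[leb]_(s in `[x, x']) p s.
Proof.
move=> t01 ip p0; apply: weighted_integral_bounds => //.
  exact: contracted_convex_point.
move=> s sx; have zx := contracted_segment_itv sx t01.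
apply/andP; split; first exact: symmetric_convex_ge_mid.
exact: (symmetric_convex_le_end cg).
Qed.

(** With [u] the contracted point, u <= y <= y' = x + x' - y <= x + x' - u, so the whole segment
    from [u] to [y'] lies between [u] and its mirror image. *)
Lemma contracted_integrand_le t s : x <= s <= x' -> 0 <= t <= 1 ->
  g (t * ((1 - alpha) * x + alpha * s) + (1 - t) * y') <=
  g ((1 - alpha) * x + alpha * s).
Proof.
move=> /contracted_point_itv /andP[xu uy] /andP[t0 t1].
have [xy yy' y'x' y'E] := contracted_order.
apply: (symmetric_convex_le cg gsym) => //.
move: (_ + alpha * s) xu uy => u xu uy.
have h : 0 <= (1 - t) * (y' - u).
  by rewrite mulr_ge0 ?subr_ge0 // (le_trans uy).
have h' : 0 <= t * (y' - u) by rewrite mulr_ge0 ?subr_ge0 // (le_trans uy).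
by apply/andP; split; lra.
Qed.

(** At time [r] the argument of [g] is affine in [s] with slope [alpha * r] and intercept [m]; it
    maps [[x, x']] onto the window of [shifted_integral_le] with e = 1 - r. *)
Lemma contracted_integral_unit_scale r : 0 < r <= 1 ->
  \int[leb]_(z in `[x + (1 - r) * (y' - x), y + (1 - r) * (y' - y)]) g z =
  alpha * r * contracted_integral g y' (cst 1) r.
Proof.
move=> /andP[r0 r1]; pose m := r * ((1 - alpha) * x) + (1 - r) * y'.
have r01 : 0 <= r <= 1 by rewrite ltW.
have k0 : 0 < alpha * r by rewrite mulr_gt0.
have lE : x + (1 - r) * (y' - x) = alpha * r * x + m by rewrite /m; ring.
have rE : y + (1 - r) * (y' - y) = alpha * r * x' + m by rewrite /m /y; ring.
have xi : x <= x <= x' by rewrite lexx ltW.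
have x'i : x <= x' <= x' by rewrite lexx ltW.
have ig : leb.-integrable `[alpha * r * x + m, alpha * r * x' + m] (EFin \o g).
  apply: (@leb_integrable_sub _ x x'); last exact: convex_on_integrable.
    have /andP[+ _] := contracted_segment_itv xi r01.
    by move/le_trans; apply; rewrite /m; lra.
  have /andP[_ +] := contracted_segment_itv x'i r01.
  by apply: le_trans; rewrite /m; lra.
rewrite lE rE leb_Rintegral_itv_affine //; congr (_ * _).
apply: eq_Rintegral => s _ /=; rewrite mulr1; congr g.
by rewrite /m; ring.
Qed.

Lemma contracted_integral_unit_one :
  \int[leb]_(z in `[x, y]) g z = alpha * contracted_integral g y' (cst 1) 1.
Proof.
have := @contracted_integral_unit_scale 1.
by rewrite ltr01 lexx subrr !mul0r !addr0 mulr1 => /(_ isT).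
Qed.

(* The chord slope of the convex map [G] from [t] to [1] is at most the slope
   from [r] to [1] for [r] near [1], where [shifted_integral_le] bounds it. *)
Lemma contracted_integral_unit_gap t : 0 <= t <= 1 ->
  contracted_integral g y' (cst 1) 1 - contracted_integral g y' (cst 1) t <=
  (1 - t) / alpha *
    (g x * (y' - x) - g y * (y' - y) - \int[leb]_(z in `[x, y]) g z).
Proof.
move=> /andP[t0]; rewrite le_eqVlt => /predU1P[->|t1].
  by rewrite !subrr !mul0r.
have [xy yy' y'x' y'E] := contracted_order.
have icst : leb.-integrable `[x, x'] (EFin \o cst (1 : R)).
  exact: leb_integrable_cst.
have cG := contracted_integral_convex icst (fun _ _ => ler01).
set G := contracted_integral g y' (cst 1) in cG *.
have t10 : 0 < 1 - t by rewrite subr_gt0.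
set B := g x * (y' - x) - g y * (y' - y) - _.
suff : alpha * ((G 1 - G t) / (1 - t)) <= B.
  rewrite -ler_pdivlMl // ler_pdivrMr // => /le_trans; apply.
  by rewrite [leLHS]mulrC mulrA.
set S := (G 1 - G t) / (1 - t).
have SE : S * (1 - t) = G 1 - G t by rewrite /S divfK // gt_eqF.
pose K := (g x - g y) / (y - x) * (y' - y) ^+ 2.
(* Here [K * e] is the second-order error of the shifted window, and [alpha * S * e] is what the
   factor [1 - e] takes off the slope. The range of [e] keeps [1 - e] strictly between [t] and 1. *)
apply: (@ler_limit _ _ _ (K + alpha * S) ((1 - t) / 2)); first by rewrite divr_gt0.
move=> e /andP[e0 et].
have e01 : 0 < e <= 1 by rewrite e0; lra.
have r01 : 0 < 1 - e <= 1 by apply/andP; split; lra.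
have := @shifted_integral_le _ _ _ g cg gsym y y' xy yy' y'x' e e01.
have := contracted_integral_unit_scale r01; rewrite subKr => ->.
rewrite /B contracted_integral_unit_one -/G -/K => bound.
have slope : e * S <= G 1 - G (1 - e).
  (* The weight for which [1 - e] is the mean of [t] and 1. *)
  pose l := e / (1 - t).
  have l01 : 0 <= l <= 1.
    rewrite /l; apply/andP; split; first by rewrite divr_ge0 // ltW.
    by rewrite ler_pdivrMr //; lra.
  have i0 : 0 <= t <= 1 by rewrite t0 ltW.
  have i1 : 0 <= (1 : R) <= 1 by rewrite ler01 lexx.
  have := cG _ _ _ i0 i1 l01; rewrite [X in G X <= _](_ : _ = 1 - e); last first.
    by rewrite /l; field; rewrite gt_eqF.
  have -> : e * S = l * (G 1 - G t) by rewrite /S /l mulrA mulrAC.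
  by lra.
have slope' : alpha * (1 - e) * (e * S) <= alpha * (1 - e) * (G 1 - G (1 - e)).
  by apply: ler_wpM2l => //; apply: mulr_ge0; [exact: ltW|case/andP: r01 => /ltW].
rewrite -(ler_pM2l e0).
clear SE slope cG; clearbody S K.
move: (G 1) (G (1 - e)) bound slope' => G1 Gr bound slope'.
by lra.
Qed.
End contracted_integral.

(** * One-sided derivatives of a convex function at the ends, and the supremum norm *)

Section one_sided_derivatives.
Variables (R : realType) (u v : R) (F : R -> R).
Hypotheses (uv : u < v) (cF : convex_on u v F).
Implicit Types s : R.

(** Comparing limits with [limr_le] requires a proper filter; since [u < v], there are nonzero
    admissible increments as small as desired. *)
Lemma within_left_end_proper :
  ProperFilter (within [set h : R | `[u, v]%classic (h + u)] 0^').
Proof.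
apply: Build_ProperFilter_ex => P [/= e e0 h].
pose d := Num.min (e / 2) (v - u).
have d0 : 0 < d by rewrite lt_min divr_gt0 // subr_gt0.
exists d; apply: h => /=.
- rewrite sub0r normrN gtr0_norm // gt_min.
  by rewrite ltr_pdivrMr // ltr_pMr // ltr1n.
- by rewrite gt_eqF.
- have duv : d <= v - u by rewrite ge_min lexx orbT.
  by rewrite in_itv /=; apply/andP; split; clearbody d; lra.
Qed.

Lemma within_right_end_proper :
  ProperFilter (within [set h : R | `[u, v]%classic (h + v)] 0^').
Proof.
apply: Build_ProperFilter_ex => P [/= e e0 h].
pose d := Num.min (e / 2) (v - u).
have d0 : 0 < d by rewrite lt_min divr_gt0 // subr_gt0.
exists (- d); apply: h => /=.
- rewrite sub0r opprK gtr0_norm // gt_min.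
  by rewrite ltr_pdivrMr // ltr_pMr // ltr1n.
- by rewrite oppr_eq0 gt_eqF.
- have duv : d <= v - u by rewrite ge_min lexx orbT.
  by rewrite in_itv /=; apply/andP; split; clearbody d; lra.
Qed.

(** For increments shorter than [s - u], the three-point inequality puts the difference quotient
    below the chord slope from [u] to [s]; the limit keeps this bound. *)
Lemma derive_within_left_end_le s : u < s <= v ->
  derivable_within `[u, v] F u ->
  derive_within `[u, v] F u <= (F s - F u) / (s - u).
Proof.
move=> /andP[us sv] dF; have pF := within_left_end_proper.
apply: limr_le => //.
have su0 : 0 < s - u by rewrite subr_gt0.
exists (s - u) => //= h; rewrite /ball_ /= sub0r normrN => hs h0.
rewrite in_itv /= lerDr => /andP[hge0 _].
have {}h0 : 0 < h by rewrite lt_neqAle eq_sym h0.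
rewrite gtr0_norm // in hs.
have h1 : u <= h + u by rewrite lerDr.
have h2 : h + u <= s by rewrite -lerBrDr ltW.
have tp := convex_on_three_points cF (lexx u) h1 h2 sv.
rewrite ler_pdivlMr // -mulrA ler_pdivrMl //.
move: tp; rewrite addrK; lra.
Qed.

Lemma derive_within_right_end_ge s : u <= s < v ->
  derivable_within `[u, v] F v ->
  (F v - F s) / (v - s) <= derive_within `[u, v] F v.
Proof.
move=> /andP[us sv] dF; have pF := within_right_end_proper.
apply: limr_ge => //.
have sv0 : 0 < v - s by rewrite subr_gt0.
exists (v - s) => //= h; rewrite /ball_ /= sub0r normrN => hs h0.
rewrite in_itv /= gerDr => /andP[_ hle0].
have {}h0 : h < 0 by rewrite lt_neqAle h0.
rewrite ltr0_norm // in hs.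
have h1 : h + v <= v by rewrite gerDr.
have h2 : s <= h + v by lra.
have tp := convex_on_three_points cF us h2 h1 (lexx v).
rewrite ler_pdivrMr // -mulrA ler_ndivlMl //.
lra.
Qed.

(** Both end tangents lie below [F] at the midpoint; the two resulting lower bounds for the midpoint
    value are added. *)
Lemma convex_on_mid_gap : derivable_within `[u, v] F u ->
  derivable_within `[u, v] F v ->
  F u + F v - 2 * F ((u + v) / 2) <=
  (v - u) / 2 * (derive_within `[u, v] F v - derive_within `[u, v] F u).
Proof.
move=> du dv.
have [uc cv] : u < (u + v) / 2 /\ (u + v) / 2 < v by move: uv => ?; split; lra.
set c := (u + v) / 2 in uc cv *.
have {}uc : u < c <= v by rewrite uc ltW.
have {}cv : u <= c < v by rewrite cv andbT; case/andP: uc => /ltW.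
have cuE : c - u = (v - u) / 2 by rewrite /c; field.
have vcE : v - c = (v - u) / 2 by rewrite /c; field.
have h0 : 0 < (v - u) / 2 by rewrite divr_gt0 // subr_gt0.
have := derive_within_left_end_le uc du; rewrite cuE ler_pdivlMr // => Lu.
have := derive_within_right_end_ge cv dv; rewrite vcE ler_pdivrMr // => Lv.
move: (derive_within _ _ _) (derive_within _ _ _) Lu Lv => Du Dv Lu Lv.
by clearbody c; lra.
Qed.
End one_sided_derivatives.

(** Boundedness matters because [sup] of an unbounded set is the default value 0. The bound is
    [M + 1] since [bM] speaks only of reals strictly above [M]. *)
Lemma sup_norm_ge (R : realType) (A : set R) (p : R -> R) s :
  [bounded p s | s in A] -> A s -> `|p s| <= sup_norm A p.
Proof.
move=> [M [_ bM]] As; apply: sup_ubound; last by exists s.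
by exists (M + 1) => _ [r Ar <-]; apply: bM Ar; rewrite ltrDl.
Qed.

(** * Reduction of [Ip2] and of the other integrals to the symmetrization of [f] *)

Section reduction_to_symmetric.
Variables (R : realType) (x x' alpha : R) (f p : R -> R).
Hypotheses (xx' : x < x') (a0 : 0 < alpha) (a12 : alpha <= 1 / 2).
Hypothesis cf : convex_on x x' f.
Hypothesis p_int : leb.-integrable `[x, x'] (EFin \o p).
Hypothesis p_sym : forall s : R, x <= s <= x' -> p s = p (x + x' - s).
Let y := (1 - alpha) * x + alpha * x'.
Let y' := alpha * x + (1 - alpha) * x'.
Let fr z := f (x + x' - z).
Let g z := f z + fr z.

Lemma convex_on_reflect : convex_on x x' fr.
Proof.
rewrite (_ : fr = fun z => f (-1 * z + (x + x'))); last first.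
  by apply/funext => z; rewrite /fr mulN1r addrC.
by apply: convex_on_affine cf => s /andP[? ?]; apply/andP; split; lra.
Qed.

Lemma symmetrization_convex : convex_on x x' g.
Proof. exact: (convex_onD cf convex_on_reflect). Qed.

Lemma symmetrization_sym z : g (x + x' - z) = g z.
Proof. by rewrite /g /fr subKr addrC. Qed.

(** Reflecting both [s] and the resulting point in the midpoint of [[x, x']] turns the second
    argument in [Ip2] into the first, so [f] can be traded for [g]. *)
Let rightE s t : t * ((1 - alpha) * x' + alpha * s) + (1 - t) * y =
  x + x' - (t * ((1 - alpha) * x + alpha * (x + x' - s)) + (1 - t) * y').
Proof. by rewrite /y /y'; ring. Qed.

Lemma right_integrand_integrable t : 0 <= t <= 1 ->
  leb.-integrable `[x, x'] (EFin \o (fun s =>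
    f (t * ((1 - alpha) * x' + alpha * s) + (1 - t) * y) * p s)).
Proof.
move=> t01; apply: convex_on_mul_integrable p_int.
have cr := contracted_convex_point xx' a0 a12 convex_on_reflect t01.
rewrite (_ : (fun s => _) = (fun s => fr (t * ((1 - alpha) * x +
    alpha * (-1 * s + (x + x'))) + (1 - t) * y'))); last first.
  by apply/funext => s; rewrite rightE mulN1r [- s + _]addrC.
apply: (convex_on_affine _ cr) => s /andP[? ?]; apply/andP; split; lra.
Qed.

Lemma left_integrand_integrable t : 0 <= t <= 1 ->
  leb.-integrable `[x, x'] (EFin \o (fun s =>
    f (t * ((1 - alpha) * x + alpha * s) + (1 - t) * y') * p s)).
Proof.
move=> t01; apply: convex_on_mul_integrable p_int.
exact: contracted_convex_point.
Qed.

Lemma Ip2_split t : 0 <= t <= 1 -> Ip2 x x' alpha f p t =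
  \int[leb]_(s in `[x, x'])
    (f (t * ((1 - alpha) * x + alpha * s) + (1 - t) * y') * p s) +
  \int[leb]_(s in `[x, x'])
    (f (t * ((1 - alpha) * x' + alpha * s) + (1 - t) * y) * p s).
Proof.
move=> t01; rewrite -RintegralD //.
- by apply: eq_Rintegral => s _; rewrite mulrDl.
- exact: leb_measurable_itv.
- exact: left_integrand_integrable.
- exact: right_integrand_integrable.
Qed.

Lemma Ip2_symmetrization t : 0 <= t <= 1 ->
  Ip2 x x' alpha f p t = contracted_integral x x' alpha g y' p t.
Proof.
move=> t01; rewrite Ip2_split //.
rewrite (leb_Rintegral_reflect (x + x') (right_integrand_integrable t01)).
rewrite addrK (addrAC x x' (- x)) subrr add0r -RintegralD //.
- apply: eq_Rintegral => s; rewrite inE /= in_itv /= => sx.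
  by rewrite -p_sym // rightE subKr -mulrDl.
- exact: leb_measurable_itv.
- exact: left_integrand_integrable.
have := leb_integrable_reflect (x + x') (right_integrand_integrable t01).
by rewrite addrK (addrAC x x' (- x)) subrr add0r.
Qed.

(** The substitution is s = (alpha r + w) / 2, of slope alpha / 2; solving for [r] gives the
    argument of [p]. *)
Lemma half_substitution w :
  leb.-integrable `[x, x'] (EFin \o (fun r => f ((alpha * r + w) / 2) * p r)) ->
  \int[leb]_(s in `[(alpha * x + w) / 2, (alpha * x' + w) / 2])
    (f s * p ((2 * s - w) / alpha)) =
  alpha / 2 * \int[leb]_(r in `[x, x']) (f ((alpha * r + w) / 2) * p r).
Proof.
move=> iH; have k0 : 0 < alpha / 2 by rewrite divr_gt0.
rewrite -(leb_Rintegral_substitution (w / 2) k0 iH).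
rewrite (_ : alpha / 2 * x + w / 2 = (alpha * x + w) / 2); last by field.
rewrite (_ : alpha / 2 * x' + w / 2 = (alpha * x' + w) / 2); last by field.
apply: eq_Rintegral => s _ /=.
by congr (f _ * p _); field; rewrite gt_eqF.
Qed.

(** At time 1/2 both arguments in [Ip2] have the form (alpha s + w) / 2, with w = (1 - alpha) x + y'
    in the first and w = (1 - alpha) x' + y in the second; the factor alpha / 2 cancels 2 /
    alpha. *)
Lemma midpoint_substitution :
  2 / alpha *
    (\int[leb]_(s in `[(x + y') / 2, (y + y') / 2])
        (f s * p (1 / alpha * (2 * s - x - y') + x)) +
     \int[leb]_(s in `[(y + y') / 2, (x' + y) / 2])
        (f s * p (1 / alpha * (2 * s - y - x') + x'))) =
  Ip2 x x' alpha f p (1 / 2).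
Proof.
have h01 : 0 <= (1 / 2 : R) <= 1 by apply/andP; split; lra.
have lE s : 1 / 2 * ((1 - alpha) * x + alpha * s) + (1 - 1 / 2) * y' =
  (alpha * s + ((1 - alpha) * x + y')) / 2 by field.
have rE s : 1 / 2 * ((1 - alpha) * x' + alpha * s) + (1 - 1 / 2) * y =
  (alpha * s + ((1 - alpha) * x' + y)) / 2 by field.
have iL := left_integrand_integrable h01.
have iR := right_integrand_integrable h01.
rewrite Ip2_split //.
under [X in _ = X + _]eq_Rintegral do rewrite lE.
under [X in _ = _ + X]eq_Rintegral do rewrite rE.
have {}iL : leb.-integrable `[x, x'] (EFin \o
    (fun s => f ((alpha * s + ((1 - alpha) * x + y')) / 2) * p s)).
  by apply: eq_integrable iL; [exact: leb_measurable_itv|move=> s _ /=; rewrite lE].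
have {}iR : leb.-integrable `[x, x'] (EFin \o
    (fun s => f ((alpha * s + ((1 - alpha) * x' + y)) / 2) * p s)).
  by apply: eq_integrable iR; [exact: leb_measurable_itv|move=> s _ /=; rewrite rE].
have := half_substitution iL; have := half_substitution iR.
rewrite (_ : alpha * x + ((1 - alpha) * x + y') = x + y'); last by ring.
rewrite (_ : alpha * x' + ((1 - alpha) * x + y') = y + y'); last first.
  by rewrite /y; ring.
rewrite (_ : alpha * x + ((1 - alpha) * x' + y) = y + y'); last first.
  by rewrite /y'; ring.
rewrite (_ : alpha * x' + ((1 - alpha) * x' + y) = x' + y); last by ring.
have pl s : 1 / alpha * (2 * s - x - y') + x =
    (2 * s - ((1 - alpha) * x + y')) / alpha by field; rewrite gt_eqF.
have pr s : 1 / alpha * (2 * s - y - x') + x' =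
    (2 * s - ((1 - alpha) * x' + y)) / alpha by field; rewrite gt_eqF.
under [X in _ -> _ -> _ * (X + _) = _]eq_Rintegral do rewrite pl.
under [X in _ -> _ -> _ * (_ + X) = _]eq_Rintegral do rewrite pr.
move=> -> ->; rewrite -mulrDr mulrA.
by rewrite (_ : 2 / alpha * (alpha / 2) = 1) ?mul1r //; field; rewrite gt_eqF.
Qed.

(** Reflection carries [[y', x']] onto [[x, y]], and [f] over the former becomes [fr] over the
    latter. *)
Lemma symmetrization_integral :
  \int[leb]_(s in `[x, y] `|` `[y', x']) f s = \int[leb]_(z in `[x, y]) g z.
Proof.
have [xy yy' y'x' y'E] := contracted_order xx' a0 a12.
rewrite -/y -/y' in xy yy' y'x' y'E.
have yx' : y <= x' by exact: le_trans yy' _.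
have xy' : x <= y' by rewrite (le_trans (ltW xy)).
have if_ : leb.-integrable `[x, x'] (EFin \o f) by exact: convex_on_integrable.
have ixy := leb_integrable_sub (lexx x) yx' if_.
have iy'x' := leb_integrable_sub xy' (lexx x') if_.
have mU : (measurable : set (set (lebT R))) (`[x, y] `|` `[y', x']).
  by apply: measurableU; exact: leb_measurable_itv.
rewrite Rintegral_setU_null; try exact: leb_measurable_itv.
- have reflE : x + x' - y' = y by rewrite y'E subKr.
  have ifr := leb_integrable_reflect (x + x') iy'x'.
  rewrite (leb_Rintegral_reflect (x + x') iy'x') addrK reflE.
  rewrite addrK reflE in ifr.
  by rewrite RintegralD //; exact: leb_measurable_itv.
(* The overlap is empty for alpha < 1/2 and the single midpoint for alpha = 1/2. *)
- rewrite (_ : _ `&` _ = `[y', y]%classic).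
    apply: (etrans (@lebesgue_measure_itv R `[y', y])).
    by rewrite /= lte_fin ltNge yy'.
  apply/seteqP; split => z /=; rewrite !in_itv /=.
    by move=> [/andP[_ zy] /andP[y'z _]]; apply/andP.
  move=> /andP[y'z zy]; rewrite zy y'z (le_trans xy') // (le_trans zy) //.
- apply: integrableS if_ => //; first exact: leb_measurable_itv.
  move=> z /= [|]; rewrite !in_itv /= => /andP[h1 h2]; apply/andP; split => //.
    exact: le_trans yx'.
  exact: le_trans h1.
Qed.
End reduction_to_symmetric.

(** * Assembly of the three groups of inequalities *)

Theorem theorem16 (R : realType) (a b x x' alpha : R) (f p : R -> R)
  (hax : a <= x) (hxx' : x < x') (hx'b : x' <= b)
  (halpha : 0 < alpha <= 1 / 2)
  (hf : convex_function `[a, b] f)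
  (hp_ge0 : forall s : R, x <= s <= x' -> 0 <= p s)
  (hp_int : leb.-integrable `[x, x'] (EFin \o p))
  (hp_sym : forall s : R, x <= s <= x' -> p s = p (x + x' - s)) :
  let y := (1 - alpha) * x + alpha * x' in
  let y' := alpha * x + (1 - alpha) * x' in
  let Omega := `[x, y] `|` `[y', x'] in
  let P := \int[leb]_(s in `[x, x']) p s in
  let J := \int[leb]_(s in `[x, x'])
             ((f ((1 - alpha) * x + alpha * s) +
               f ((1 - alpha) * x' + alpha * s)) * p s) in
  let M := 2 / alpha *
    (\int[leb]_(s in `[(x + y') / 2, (y + y') / 2])
        (f s * p (1 / alpha * (2 * s - x - y') + x)) +
     \int[leb]_(s in `[(y + y') / 2, (x' + y) / 2])
        (f s * p (1 / alpha * (2 * s - y - x') + x'))) in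
  let Df := derive_within `[x, x'] f in
  [/\
    [/\ 2 * f ((y + y') / 2) * P <= M,
        M <= \int[leb]_(t in `[0, 1]) Ip2 x x' alpha f p t
      & \int[leb]_(t in `[0, 1]) Ip2 x x' alpha f p t
          <= 1 / 2 * ((f y + f y') * P + J)],
    ((forall s : R, x <= s <= x' -> derivable_within `[x, x'] f s) ->
      [bounded p s | s in `[x, x']] ->
      forall t : R, 0 <= t <= 1 ->
        0 <= J - Ip2 x x' alpha f p t
          <= (1 - t) / alpha *
             ((f x + f x') * (y' - x) - (f y + f y') * (y' - y)
                - \int[leb]_(s in Omega) f s) * sup_norm `[x, x'] p)
  & ((forall s : R, x <= s <= x' -> derivable_within `[x, x'] f s) ->
      forall t : R, 0 <= t <= 1 ->
        0 <= Ip2 x x' alpha f p t - 2 * f ((y + y') / 2) * P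
          <= (2 * x' - y - y') / 2 * (Df x' - Df x) * P /\
        0 <= (f x + f x') * P - Ip2 x x' alpha f p t
          <= (2 * x' - y - y') / 2 * (Df x' - Df x) * P)].
Proof.
move=> y y' Omega P J M Df.
have [a0 a12] := andP halpha.
have cf : convex_on x x' f.
  exact: convex_on_sub hax hx'b (convex_function_on hf).
set g := fun z => f z + f (x + x' - z).
have cg : convex_on x x' g by exact: symmetrization_convex.
have gsym z : g (x + x' - z) = g z by exact: symmetrization_sym.
pose C := contracted_integral x x' alpha g y'.
have Ip2E t : 0 <= t <= 1 -> Ip2 x x' alpha f p t = C p t.
  exact: Ip2_symmetrization.
have i0 : 0 <= (0 : R) <= 1 by rewrite lexx ler01.
have i1 : 0 <= (1 : R) <= 1 by rewrite ler01 lexx.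
have ih : 0 <= (1 / 2 : R) <= 1 by apply/andP; split; lra.
have P0 : 0 <= P.
  by apply: Rintegral_ge0 => s; rewrite /= in_itv /= => /hp_ge0.
have [xy yy' y'x' y'E] := contracted_order hxx' a0 a12.
rewrite -/y -/y' in xy yy' y'x' y'E.
have yyE : y + y' = x + x' by rewrite y'E addrC subrK.
have gmid : g ((x + x') / 2) = 2 * f ((y + y') / 2).
  rewrite yyE /g (_ : x + x' - _ = (x + x') / 2); last by field.
  by ring.
have gx : g x = f x + f x' by rewrite /g addrAC subrr add0r.
have gy : g y = f y + f y' by rewrite /g -y'E.
have gy' : g y' = f y + f y' by rewrite -gy y'E gsym.
(* The values at times 1 and 0 are the two end terms of the Hermite-Hadamard upper bound. *)
have JE : J = C p 1.
  rewrite -Ip2E //; apply: eq_Rintegral => s _.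
  by rewrite subrr !mul0r !mul1r !addr0.
have C0E : C p 0 = (f y + f y') * P.
  rewrite /C /contracted_integral -RintegralZl //; last exact: leb_measurable_itv.
  by apply: eq_Rintegral => s _; rewrite mul0r add0r subr0 mul1r gy'.
(* At time 1/2 this is the first inequality of (1); at general [t] it gives the lower bounds of
   (3). *)
have bC t : 0 <= t <= 1 -> 2 * f ((y + y') / 2) * P <= C p t <= (f x + f x') * P.
  move=> t01; rewrite -gmid -gx.
  exact: contracted_integral_bounds.
have cC : convex_on 0 1 (C p) by exact: contracted_integral_convex.
split.
- have ME : M = C p (1 / 2) by rewrite -Ip2E // -midpoint_substitution.
  have -> : \int[leb]_(t in `[0, 1]) Ip2 x x' alpha f p t =
      \int[leb]_(t in `[0, 1]) C p t.
    apply: eq_Rintegral => t; rewrite inE /= in_itv /=; exact: Ip2E.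
  have /andP[h1 h2] := hermite_hadamard cC.
  rewrite ME JE -C0E; split => //.
  by have /andP[] := bC _ ih.
- move=> _ pb t t01; rewrite Ip2E // JE.
  pose N := sup_norm `[x, x'] p.
  have mxx' := @leb_measurable_itv R `[x, x'].
  have gap0 s : x <= s <= x' ->
      0 <= g ((1 - alpha) * x + alpha * s) -
           g (t * ((1 - alpha) * x + alpha * s) + (1 - t) * y').
    move=> sx; rewrite subr_ge0.
    exact: (contracted_integrand_le hxx' a0 a12 cg gsym sx t01).
  have cE q : C q 1 =
      \int[leb]_(s in `[x, x']) (g ((1 - alpha) * x + alpha * s) * q s).
    by apply: eq_Rintegral => s _; rewrite subrr mul0r mul1r addr0.
  have c1 : convex_on x x' (fun s => g ((1 - alpha) * x + alpha * s)).
    have := contracted_convex_point hxx' a0 a12 cg i1.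
    by under eq_fun do rewrite subrr mul0r mul1r addr0.
  have ct := contracted_convex_point hxx' a0 a12 cg t01.
  have gapE q : leb.-integrable `[x, x'] (EFin \o q) ->
      C q 1 - C q t = \int[leb]_(s in `[x, x'])
        ((g ((1 - alpha) * x + alpha * s) -
          g (t * ((1 - alpha) * x + alpha * s) + (1 - t) * y')) * q s).
    move=> iq; rewrite cE -RintegralB //.
    + by apply: eq_Rintegral => s _; rewrite -mulrBl.
    + exact: convex_on_mul_integrable c1 iq.
    + exact: convex_on_mul_integrable ct iq.
  have igap q : leb.-integrable `[x, x'] (EFin \o q) ->
      leb.-integrable `[x, x'] (EFin \o (fun s =>
        (g ((1 - alpha) * x + alpha * s) -
         g (t * ((1 - alpha) * x + alpha * s) + (1 - t) * y')) * q s)).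
    move=> iq; have := integrableB mxx' (convex_on_mul_integrable c1 iq)
      (convex_on_mul_integrable ct iq).
    by apply: eq_integrable => // s _; rewrite /= -EFinB -mulrBl.
  apply/andP; split.
    rewrite gapE //; apply: Rintegral_ge0 => s; rewrite /= in_itv /= => sx.
    by rewrite mulr_ge0 ?gap0 ?hp_ge0.
  have icst := @leb_integrable_cst R x x'.
  have xi : `[x, x']%classic x by rewrite /= in_itv /= lexx ltW.
  have N0 : 0 <= N by apply: le_trans (sup_norm_ge pb xi).
  (* The intermediate term is the gap for unit weight times [N]: [p <= N] against the nonnegative
     gap on one side, [contracted_integral_unit_gap] on the other. *)
  apply: (@le_trans _ _ ((C (cst 1) 1 - C (cst 1) t) * N)); last first.
    apply: ler_wpM2r => //.
    have := contracted_integral_unit_gap hxx' a0 a12 cg gsym t01.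
    by rewrite -/y -/y' -/C gx gy /Omega symmetrization_integral.
  rewrite !gapE // -RintegralZr //; last exact: igap.
  apply: le_Rintegral => //; first exact: igap.
    apply: eq_integrable (igap (cst N) (icst N)) => // s _ /=.
    by rewrite mulr1.
  move=> s; rewrite /= in_itv /= => sx; rewrite mulr1.
  apply: ler_wpM2l; first exact: gap0.
  have sx' : `[x, x']%classic s by rewrite /= in_itv.
  exact: le_trans (ler_norm _) (sup_norm_ge pb sx').
- move=> df t t01; have /andP[lo hi] := bC t t01; rewrite Ip2E //.
  (* Since [Ip2] lies between the two subtracted quantities, this one bound on their difference
     yields both upper bounds of (3). *)
  have gap : (f x + f x') * P - 2 * f ((y + y') / 2) * P <=
      (2 * x' - y - y') / 2 * (Df x' - Df x) * P.
    rewrite -mulrBl ler_wpM2r // yyE.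
    rewrite (_ : 2 * x' - y - y' = x' - x); last by rewrite y'E; ring.
    apply: convex_on_mid_gap => //; apply: df; rewrite lexx ltW //.
  by split; apply/andP; split; lra.
Qed.
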